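(* Let $T>0$ and let $\lambda:[0,T]\times\mathbb{R}\to\mathbb{R}$ be a continuous function such that (i) $y\mapsto\sup_{t\in[0,T]}|\lambda(t,y)|$ belongs to $L^1(\mathbb{R})$, and (ii) the partial derivative $\lambda_t$ exists, is continuous, and $y\mapsto\sup_{t\in[0,T]}|\lambda_t(t,y)|$ belongs to $L^1(\mathbb{R})$. Then the function $$\phi(t,y)\triangleq\int_0^y\exp\Big(2\int_0^s\lambda(t,r)\,dr\Big)ds,\qquad(t,y)\in[0,T]\times\mathbb{R},$$ satisfies $\phi_{yy}(t,y)-2\lambda(t,y)\phi_y(t,y)=0$, and has the following properties: 1. For every $t\in[0,T]$, $\phi(t,\cdot)$ is a one-to-one function from $\mathbb{R}$ onto $\mathbb{R}$, both $\phi(t,\cdot)$ and its inverse $\phi^{-1}(t,\cdot)$ are smooth, and they are globally Lipschitz in $y$: there is a constant $L$ such that $|\phi(t,y)-\phi(t,\bar y)|\le L|y-\bar y|$ and $|\phi^{-1}(t,y)-\phi^{-1}(t,\bar y)|\le L|y-\bar y|$ for all $t\in[0,T]$, $y,\bar y\in\mathbb{R}$. 2. $\phi_y$ is a positive bounded function, and $\phi_t$ is continuous in $t$ and Lipschitz continuous in $y$.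
   Context: Subscripts denote partial derivatives: $\phi_t,\phi_y,\phi_{yy}$, $\lambda_t$. *)

(* Defs.v *)
From Stdlib Require Import Reals.
From mathcomp Require Import all_boot all_algebra.
From mathcomp Require Import all_classical all_reals all_analysis.
From mathcomp Require Import Rstruct Rstruct_topology.

Local Open Scope classical_set_scope.
Local Open Scope ring_scope.

Definition sup_abs_t (T : Rdefinitions.R) (f : Rdefinitions.R -> Rdefinitions.R -> Rdefinitions.R)
  (y : Rdefinitions.R) : Rdefinitions.R :=
  sup [set `|f t y| | t in `[0, T]%classic].

Definition L1 (g : Rdefinitions.R -> Rdefinitions.R) : Prop :=
  (@lebesgue_measure Rdefinitions.R).-integrable setT (fun y => (g y)%:E).

Local Close Scope ring_scope.
Local Open Scope R_scope.

Definition cont_on_strip (T : Rdefinitions.R) (f : Rdefinitions.R -> Rdefinitions.R -> Rdefinitions.R) : Prop :=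
  forall t y, 0 <= t <= T -> forall eps, 0 < eps ->
    exists delta, 0 < delta /\
      forall t' y', 0 <= t' <= T -> Rabs (t' - t) < delta -> Rabs (y' - y) < delta ->
        Rabs (f t' y' - f t y) < eps.

(* Main.v *)
(* The primitive Λ(t,y) = ∫_0^y λ(t,r) dr is bounded, uniformly in (t,y), by
   C = ∫ sup_t |λ(t,·)|, so φ_y = exp(2Λ) lies in [exp(-2C), exp(2C)]: each
   φ(t,·) is bi-Lipschitz, hence a bijection of R, and its inverse has derivative
   exp(-2Λ∘φ⁻¹).  Likewise Λ_t is bounded by C' = ∫ sup_t |λ_t(t,·)|, and
   φ_t = ∫_0^y 2 Λ_t φ_y has y-derivative bounded by 2 C' exp(2C).  To integrate
   and differentiate under the integral sign, λ and λ_t are extended to all times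
   by freezing t outside [0,T], which turns continuity on the strip into
   continuity on the plane. *)

Require Import Defs.
From Stdlib Require Import Reals.
From mathcomp Require all_boot all_order all_algebra all_classical all_reals all_analysis Rstruct Rstruct_topology.
From Stdlib Require Import Lra ClassicalEpsilon FunctionalExtensionality.

Module LebesgueBounds.
Import all_boot all_order all_algebra all_classical all_reals all_analysis Rstruct Rstruct_topology.
Import Order.TTheory GRing.Theory Num.Theory numFieldNormedType.Exports.
Local Open Scope classical_set_scope.
Local Open Scope ring_scope.

Lemma derivable_pt_lim_derive1 {F : R -> R} {x l : R} : derivable_pt_lim F x l ->
  derivable (F : R^o -> R^o) x 1 /\ derive1 (F : R^o -> R^o) x = l.
Proof.
move=> dF.
pose q h := if h == 0 then l else (F (h + x) - F x) / h.
have cq : continuity_pt q 0.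
  move=> eps /dF [del Hd]; exists del; split; first exact: cond_pos del.
  move=> y [[_ Hy0] Hyd].
  rewrite /q eqxx; have /negbTE -> : y != 0 by apply/eqP => y0; apply: Hy0; rewrite y0.
  rewrite /R_dist /=.
  have := Hd y (fun h => Hy0 (esym h)).
  rewrite /dist /= /R_dist Rminus_0_r in Hyd.
  by move=> /(_ Hyd); rewrite Rplus_comm.
move/continuity_pt_cvg': cq; rewrite /q eqxx => cq.
split.
  apply/cvg_ex; exists l; apply: cvg_trans cq; apply: near_eq_cvg; near=> h.
  have hn0 : h != 0 by near: h; exact: nbhs_dnbhs_neq.
  by rewrite /= (negbTE hn0) /GRing.scale /= mulr1 mulrC.
apply: cvg_lim => //; apply: cvg_trans cq; apply: near_eq_cvg; near=> h.
have hn0 : h != 0 by near: h; exact: nbhs_dnbhs_neq.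
by rewrite /= (negbTE hn0) /GRing.scale /= mulrC.
Unshelve. all: by end_near.
Qed.

Lemma integral_continuous_FTC (g F : R -> R) a b : a < b ->
  (forall x, continuity_pt g x) -> (forall x, derivable_pt_lim F x (g x)) ->
  (\int[@lebesgue_measure R]_(x in `[a, b]) (g x)%:E = (F b - F a)%:E)%E.
Proof.
move=> ab cg dF.
have ctsF : continuous (F : R^o -> R^o).
  move=> x; apply/continuity_pt_cvg.
  exact: (derivable_continuous_pt F x (exist _ (g x) (dF x))).
have dF' : derivable_oo_LRcontinuous (F : R^o -> R^o) a b.
  split.
  - by move=> x _; exact: (derivable_pt_lim_derive1 (dF x)).1.
  - exact/cvg_at_right_filter/ctsF.
  - exact/cvg_at_left_filter/ctsF.
apply: continuous_FTC2 ab _ dF' _.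
- by apply: continuous_subspaceT => x; apply/continuity_pt_cvg.
- by move=> x _; exact: (derivable_pt_lim_derive1 (dF x)).2.
Qed.

Lemma L1_increment_bound (G : R -> R) : L1 G -> exists C : R,
  forall (g F : R -> R) (a b : R), Rle a b ->
  (forall x, continuity_pt g x) -> (forall x, derivable_pt_lim F x (g x)) ->
  (forall r, Rle (Rabs (g r)) (G r)) -> Rle (Rabs (F b - F a)) C.
Proof.
move=> iG; exists (Rintegral (@lebesgue_measure R) setT G).
move=> g F a b /RleP ab cg dF gG.
have G0 r : 0 <= G r by apply/RleP; apply: Rle_trans (gG r); exact: Rabs_pos.
have intG_ge0 : 0 <= Rintegral (@lebesgue_measure R) setT G.
  by apply: Rintegral_ge0.
have [<-|neq_ab] := eqVneq a b; first by rewrite Rminus_diag Rabs_R0; apply/RleP.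
have {neq_ab} {}ab : a < b by rewrite lt_neqAle neq_ab ab.
have cabs_g : continuous ((fun x => Rabs (g x)) : R^o -> R^o).
  move=> x; apply/continuity_pt_cvg.
  exact: (continuity_pt_comp g Rabs x (cg x) (Rcontinuity_abs _)).
have int_abs_g : (@lebesgue_measure R).-integrable `[a, b] (EFin \o (fun x => Rabs (g x))).
  apply: continuous_compact_integrable; [exact: segment_compact|exact: continuous_subspaceT].
case/integrableP: (iG) => mG _.
have iGfin : (\int[@lebesgue_measure R]_(x in setT) (G x)%:E)%E \is a fin_num.
  rewrite ge0_fin_numE; first exact: integrable_lty iG.
  by apply: integral_ge0 => x _; rewrite lee_fin.
have int_g : (@lebesgue_measure R).-integrable `[a, b] (EFin \o g).
  apply: continuous_compact_integrable; first exact: segment_compact.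
  by apply: continuous_subspaceT => x; apply/continuity_pt_cvg.
case/integrableP: int_g => mg _.
apply/RleP; rewrite -lee_fin /Rintegral fineK //.
rewrite -[Rabs _]/(`|F b - F a|) -abse_EFin -(integral_continuous_FTC _ _ _ _ ab cg dF).
apply: (le_trans (le_abse_integral _ _ _)) => //.
apply: (@le_trans _ _ (\int[@lebesgue_measure R]_(x in `[a, b]) (G x)%:E)%E).
  apply: ge0_le_integral => //.
  - by case/integrableP: int_abs_g.
  - exact: measurable_funS mG.
  - by move=> x _; rewrite abse_EFin lee_fin; apply/RleP; exact: gG.
by apply: ge0_subset_integral => // x _; rewrite lee_fin.
Qed.

Lemma sup_abs_t_ge (T : R) (f : R -> R -> R) y M :
  (forall t, Rle 0 t -> Rle t T -> Rle (Rabs (f t y)) M) ->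
  forall t, Rle 0 t -> Rle t T -> Rle (Rabs (f t y)) (sup_abs_t T f y).
Proof.
move=> HM t t0 tT.
have hub : has_ubound [set `|f t y| | t in `[0, T]%classic].
  exists M => _ [s /= + <-]; rewrite in_itv /= => /andP[/RleP s0 /RleP sT].
  exact/RleP/HM.
apply/RleP; apply: (ub_le_sup hub).
by exists t => //=; rewrite in_itv /=; apply/andP; split; exact/RleP.
Qed.

End LebesgueBounds.

From Coquelicot Require Import Coquelicot.
Open Scope R_scope.

Lemma ex_RInt_cont (f : R -> R) a b : (forall t, continuous f t) -> ex_RInt f a b.
Proof. intros cf; apply (@ex_RInt_continuous R_CompleteNormedModule); intros; apply cf. Qed.

Lemma locally_between (P : R -> Prop) x a b : a < x < b ->
  (forall y, a < y < b -> P y) -> locally x P.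
Proof. intros [ax xb] H; apply (locally_interval P x (Finite a) (Finite b)); simpl; auto. Qed.

Lemma abs_RInt_le_len_mul (f : R -> R) a b M :
  (forall t, continuous f t) ->
  (forall t, Rmin a b <= t <= Rmax a b -> Rabs (f t) <= M) ->
  Rabs (RInt f a b) <= Rabs (b - a) * M.
Proof.
intros cf Hb.
destruct (Rle_or_lt a b) as [ab|ab].
- rewrite (Rabs_right (b - a)) by lra.
  apply abs_RInt_le_const; auto using ex_RInt_cont.
  intros t Ht; apply Hb; rewrite Rmin_left, Rmax_right; lra.
- rewrite <- opp_RInt_swap by auto using ex_RInt_cont.
  unfold opp; simpl; rewrite Rabs_Ropp, (Rabs_left (b - a)), Ropp_minus_distr by lra.
  apply abs_RInt_le_const; auto using ex_RInt_cont; try lra.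
  intros t Ht; apply Hb; rewrite Rmin_right, Rmax_left; lra.
Qed.

Lemma RInt_ge_len_mul (f : R -> R) a b m : a <= b ->
  (forall t, continuous f t) ->
  (forall t, a <= t <= b -> m <= f t) ->
  m * (b - a) <= RInt f a b.
Proof.
intros ab cf Hm.
replace (m * (b - a)) with (RInt (fun _ => m) a b).
- apply RInt_le; auto using ex_RInt_const, ex_RInt_cont.
  intros; apply Hm; lra.
- rewrite RInt_const; unfold scal; simpl; unfold mult; simpl; ring.
Qed.

Lemma RInt_Chasles_sub (f : R -> R) a b c :
  (forall t, continuous f t) -> RInt f a b - RInt f a c = RInt f c b.
Proof.
intros cf.
rewrite <- (RInt_Chasles f a c b) by auto using ex_RInt_cont.
unfold plus; simpl; ring.
Qed.

Lemma is_derive_RInt_upper (f : R -> R) a x :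
  (forall t, continuous f t) -> is_derive (fun u => RInt f a u) x (f x).
Proof.
intros cf; apply (is_derive_RInt f (fun u => RInt f a u) a x); auto.
apply filter_forall; intros y; exact (RInt_correct _ _ _ (ex_RInt_cont _ _ _ cf)).
Qed.

Lemma is_derive_cont (f : R -> R) x l : is_derive f x l -> continuous f x.
Proof. intros H; apply (ex_derive_continuous (K:=R_AbsRing) (V:=R_NormedModule)); exists l; exact H. Qed.

Lemma is_derive_eq (f : R -> R) x l l' : is_derive f x l -> l = l' -> is_derive f x l'.
Proof. intros H ->; exact H. Qed.

Lemma C2_of_derivatives (f g h : R -> R) :
  (forall y, is_derive f y (g y)) -> (forall y, is_derive g y (h y)) ->
  (forall y, continuous h y) ->
  (forall y, ex_derive f y /\ ex_derive (Derive f) y) /\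
  (forall y, continuous (Derive (Derive f)) y).
Proof.
intros df dg ch.
assert (Df : Derive f = g)
  by (apply functional_extensionality; intros y; apply is_derive_unique, df).
assert (Dg : Derive g = h)
  by (apply functional_extensionality; intros y; apply is_derive_unique, dg).
rewrite Df, Dg; split; [intros y; split; [exists (g y)|exists (h y)]|]; auto.
Qed.

Lemma continuity_2d_pt_snd (F : R -> R -> R) s u :
  continuity_2d_pt F s u -> continuous (F s) u.
Proof.
intros H; apply continuity_pt_filterlim, continuity_pt_locally; intros eps.
destruct (H eps) as [d Hd].
apply (locally_between _ u (u - d) (u + d)); [destruct d; simpl; lra|].
intros y Hy; apply Hd; [rewrite Rminus_diag, Rabs_R0; apply cond_pos|apply Rabs_def1; lra].
Qed.

Lemma continuity_2d_pt_fst (F : R -> R -> R) s u :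
  continuity_2d_pt F s u -> continuous (fun s => F s u) s.
Proof.
intros H; apply continuity_pt_filterlim, continuity_pt_locally; intros eps.
destruct (H eps) as [d Hd].
apply (locally_between _ s (s - d) (s + d)); [destruct d; simpl; lra|].
intros y Hy; apply Hd; [apply Rabs_def1; lra|rewrite Rminus_diag, Rabs_R0; apply cond_pos].
Qed.

Lemma exp_le_exp a b : a <= b -> exp a <= exp b.
Proof. intros [ab|<-]; [left; apply exp_increasing, ab|right; reflexivity]. Qed.

Section ParametricIntegral.

Variable F : R -> R -> R.
Hypothesis cF : forall s r, continuity_2d_pt F s r.

Let cF_snd s r : continuous (F s) r.
Proof. apply continuity_2d_pt_snd, cF. Qed.

Lemma RInt_param_uniform s v (eps : posreal) : exists d : posreal,
  forall s', Rabs (s' - s) < d -> Rabs (RInt (fun r => F s' r - F s r) 0 v) <= eps.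
Proof.
assert (v1 : 0 < Rabs v + 1) by (pose proof (Rabs_pos v); lra).
assert (eps'_pos : 0 < eps / (Rabs v + 1)) by (apply Rdiv_lt_0_compat; [apply cond_pos|lra]).
destruct (uniform_continuity_2d F (s - 1) (s + 1) (Rmin 0 v) (Rmax 0 v)
  (fun x y _ _ => cF x y) (mkposreal _ eps'_pos)) as [d Hd]; simpl in Hd.
assert (d_pos : 0 < Rmin d 1) by (apply Rmin_pos; [apply cond_pos|lra]).
exists (mkposreal _ d_pos); simpl; intros s' Hs.
pose proof (Rmin_l d 1); pose proof (Rmin_r d 1).
apply Rle_trans with (Rabs (v - 0) * (eps / (Rabs v + 1))).
- apply abs_RInt_le_len_mul.
  + intros; apply (continuous_minus (V:=R_NormedModule)); apply cF_snd.
  + intros t Ht; left; apply (Hd s t s' t); try lra.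
    * apply Rabs_def2 in Hs; lra.
    * rewrite Rminus_diag, Rabs_R0; apply cond_pos.
- assert (k_def : eps / (Rabs v + 1) * (Rabs v + 1) = eps) by (field; lra).
  rewrite Rminus_0_r; nra.
Qed.

Lemma RInt_param_local_bound s v : exists d : posreal, forall s' v',
  Rabs (s' - s) < d -> Rabs (v' - v) < d ->
  Rabs (RInt (F s') v v') <= Rabs (v' - v) * (Rabs (F s v) + 1).
Proof.
destruct (cF s v (mkposreal 1 Rlt_0_1)) as [d Hd]; simpl in Hd.
exists d; intros s' v' Hs Hv.
apply abs_RInt_le_len_mul; [apply cF_snd|].
intros t Ht.
assert (Rabs (t - v) <= Rabs (v' - v)).
{ destruct (Rle_or_lt v v').
  - rewrite Rmin_left, Rmax_right in Ht by lra; rewrite !Rabs_right by lra; lra.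
  - rewrite Rmin_right, Rmax_left in Ht by lra; rewrite !Rabs_left1 by lra; lra. }
pose proof (Hd s' t Hs ltac:(lra)); pose proof (Rabs_triang_inv (F s' t) (F s v)); lra.
Qed.

Lemma continuity_2d_pt_RInt s v :
  continuity_2d_pt (fun s' v' => RInt (F s') 0 v') s v.
Proof.
intros eps.
destruct (RInt_param_uniform s v (pos_div_2 eps)) as [d1 H1].
destruct (RInt_param_local_bound s v) as [d0 H0].
set (M := Rabs (F s v) + 1).
assert (M_pos : 0 < M) by (unfold M; pose proof (Rabs_pos (F s v)); lra).
assert (k_pos : 0 < eps / (2 * (M + 1))) by (apply Rdiv_lt_0_compat; [apply cond_pos|lra]).
assert (d_pos : 0 < Rmin (Rmin d0 d1) (eps / (2 * (M + 1))))
  by (repeat apply Rmin_pos; try apply cond_pos; lra).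
exists (mkposreal _ d_pos); simpl; intros s' v' Hs Hv.
pose proof (Rmin_l (Rmin d0 d1) (eps / (2 * (M + 1)))).
pose proof (Rmin_r (Rmin d0 d1) (eps / (2 * (M + 1)))).
pose proof (Rmin_l d0 d1); pose proof (Rmin_r d0 d1).
replace (RInt (F s') 0 v' - RInt (F s) 0 v) with
  (RInt (F s') v v' + RInt (fun r => F s' r - F s r) 0 v).
2:{ rewrite <- (RInt_Chasles_sub (F s') 0 v' v) by auto.
    rewrite (RInt_minus (V:=R_CompleteNormedModule)) by auto using ex_RInt_cont.
    unfold minus, plus, opp; simpl; ring. }
assert (B0 : Rabs (RInt (F s') v v') < eps / 2).
{ eapply Rle_lt_trans; [apply H0; lra|].
  assert (k_def : eps / (2 * (M + 1)) * (2 * (M + 1)) = eps) by (field; lra).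
  fold M; pose proof (Rabs_pos (v' - v)); nra. }
pose proof (H1 s' ltac:(lra)); simpl in *.
pose proof (Rabs_triang (RInt (F s') v v') (RInt (fun r => F s' r - F s r) 0 v)).
lra.
Qed.

Lemma is_derive_RInt_param_cont (DF : R -> R -> R) s a b :
  locally s (fun z => forall r, is_derive (fun z => F z r) z (DF z r)) ->
  (forall z r, continuity_2d_pt DF z r) ->
  is_derive (fun z => RInt (F z) a b) s (RInt (DF s) a b).
Proof.
intros dF cDF.
assert (DF_eq : forall r, Derive (fun z => F z r) s = DF s r).
{ intros r; apply is_derive_unique, (locally_singleton _ _ dF). }
apply (is_derive_eq _ _ (RInt (fun t => Derive (fun z => F z t) s) a b)).
- apply (is_derive_RInt_param F a b s).
  + apply (filter_imp _ _ (fun z Hz t _ => ex_intro _ (DF z t) (Hz t)) dF).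
  + intros t _; apply (continuity_2d_pt_ext_loc DF); [|apply cDF].
    destruct dF as [d Hd]; exists d; intros u w Hu _.
    symmetry; apply is_derive_unique, Hd, Hu.
  + apply filter_forall; intros y; apply ex_RInt_cont, cF_snd.
- apply RInt_ext; intros x _; apply DF_eq.
Qed.

End ParametricIntegral.

Definition clamp (T t : R) := Rmax 0 (Rmin T t).

Definition extend (T : R) (f : R -> R -> R) s := f (clamp T s).

Section Extension.

Variable T : R.

Lemma clamp_id t : 0 <= t <= T -> clamp T t = t.
Proof. unfold clamp, Rmax, Rmin; destruct (Rle_dec T t); destruct (Rle_dec 0 _); lra. Qed.

Lemma clamp_lipschitz u v : Rabs (clamp T u - clamp T v) <= Rabs (u - v).
Proof.
unfold clamp, Rmax, Rmin; destruct (Rle_dec T u); destruct (Rle_dec T v);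
repeat match goal with |- context [Rle_dec ?a ?b] => destruct (Rle_dec a b) end;
unfold Rabs; repeat match goal with |- context [Rcase_abs ?a] => destruct (Rcase_abs a) end;
lra.
Qed.

Lemma extend_eq (f : R -> R -> R) t : 0 <= t <= T -> extend T f t = f t.
Proof. intros Ht; unfold extend; rewrite clamp_id; auto. Qed.

Lemma is_derive_extend (f df : R -> R -> R) :
  (forall t y, 0 < t < T -> is_derive (fun s => f s y) t (df t y)) ->
  forall t y, 0 < t < T -> is_derive (fun s => extend T f s y) t (extend T df t y).
Proof.
intros dF t y Ht.
rewrite (extend_eq df) by lra.
apply (is_derive_ext_loc (fun s => f s y)); [|apply dF; auto].
apply (locally_between _ t 0 T Ht); intros s Hs; rewrite extend_eq; auto; lra.
Qed.

Hypothesis T_ge0 : 0 <= T.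

Lemma clamp_in t : 0 <= clamp T t <= T.
Proof. unfold clamp, Rmax, Rmin; destruct (Rle_dec T t); destruct (Rle_dec 0 _); lra. Qed.

Variable f : R -> R -> R.

Lemma continuity_2d_pt_extend : cont_on_strip T f ->
  forall s u, continuity_2d_pt (extend T f) s u.
Proof.
intros cf s u eps.
destruct (cf (clamp T s) u (clamp_in s) eps (cond_pos eps)) as [d [d_pos Hd]].
exists (mkposreal d d_pos); simpl; intros s' u' Hs Hu.
apply Hd; auto using clamp_in.
pose proof (clamp_lipschitz s' s); lra.
Qed.

Lemma abs_extend_le_sup : cont_on_strip T f ->
  forall s r, Rabs (extend T f s r) <= sup_abs_t T f r.
Proof.
intros cf s r.
destruct (continuity_ab_maj (fun t => Rabs (extend T f t r)) 0 T T_ge0) as [t_max [Hmax _]].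
{ intros t _; apply continuity_pt_comp with (f2 := Rabs); [|apply Rcontinuity_abs].
  apply continuity_pt_filterlim, continuity_2d_pt_fst, continuity_2d_pt_extend, cf. }
apply (LebesgueBounds.sup_abs_t_ge T f r (Rabs (extend T f t_max r))); try apply clamp_in.
intros t t0 tT; rewrite <- (clamp_id t) at 1 by lra; apply Hmax; lra.
Qed.

Lemma primitive_extend_bounded : cont_on_strip T f -> L1 (sup_abs_t T f) ->
  exists C, forall s u, Rabs (RInt (extend T f s) 0 u) <= C.
Proof.
intros cf iG.
destruct (LebesgueBounds.L1_increment_bound _ iG) as [C HC].
exists C; intros s u.
assert (cfs : forall x, continuous (extend T f s) x)
  by (intros; apply continuity_2d_pt_snd, continuity_2d_pt_extend, cf).
assert (Hab : forall a b, a <= b ->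
  Rabs (RInt (extend T f s) 0 b - RInt (extend T f s) 0 a) <= C).
{ intros a b ab; apply (HC (extend T f s) (RInt (extend T f s) 0)); auto.
  - intros x; apply continuity_pt_filterlim, cfs.
  - intros x; apply is_derive_Reals, is_derive_RInt_upper, cfs.
  - intros r; apply abs_extend_le_sup, cf. }
pose proof (RInt_point 0 (extend T f s)) as I00.
destruct (Rle_or_lt 0 u).
- specialize (Hab 0 u H); rewrite I00, Rminus_0_r in Hab; exact Hab.
- specialize (Hab u 0 ltac:(lra)); rewrite I00, Rminus_0_l, Rabs_Ropp in Hab; exact Hab.
Qed.

End Extension.

Definition scale_density (l : R -> R) u := exp (2 * RInt l 0 u).

Definition scale (l : R -> R) y := RInt (scale_density l) 0 y.

Definition scale_inv (l : R -> R) z := epsilon (inhabits 0) (fun y => scale l y = z).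

Definition scale_inv_density (l : R -> R) z := exp (- (2 * RInt l 0 (scale_inv l z))).

Section Scale.

Variable l : R -> R.
Hypothesis l_cont : forall t, continuous l t.

Lemma is_derive_double_primitive y : is_derive (fun u => 2 * RInt l 0 u) y (2 * l y).
Proof. apply (is_derive_scal (fun u => RInt l 0 u)), is_derive_RInt_upper, l_cont. Qed.

Lemma continuous_scale_density u : continuous (scale_density l) u.
Proof.
apply continuous_exp_comp, (is_derive_cont _ _ (2 * l u)), is_derive_double_primitive.
Qed.

Lemma is_derive_scale y : is_derive (scale l) y (scale_density l y).
Proof. apply is_derive_RInt_upper, continuous_scale_density. Qed.

Lemma Derive_scale : Derive (scale l) = scale_density l.
Proof. apply functional_extensionality; intros y; apply is_derive_unique, is_derive_scale. Qed.

Lemma is_derive_scale_density y :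
  is_derive (scale_density l) y (2 * l y * scale_density l y).
Proof.
apply (is_derive_comp exp (fun u => 2 * RInt l 0 u)).
- apply is_derive_exp.
- apply is_derive_double_primitive.
Qed.

Lemma scale_ode y : ex_derive (scale l) y /\
  is_derive (fun z => Derive (scale l) z) y (2 * l y * Derive (scale l) y).
Proof.
rewrite Derive_scale; split; [exists (scale_density l y); apply is_derive_scale|].
apply is_derive_scale_density.
Qed.

Lemma scale_sub y yb : scale l y - scale l yb = RInt (scale_density l) yb y.
Proof. apply RInt_Chasles_sub, continuous_scale_density. Qed.

Variable C : R.
Hypothesis primitive_bound : forall u, Rabs (RInt l 0 u) <= C.

Lemma scale_density_bounds y :
  exp (- (2 * C)) <= scale_density l y <= exp (2 * C).
Proof.
pose proof (proj1 (Rabs_le_between _ _) (primitive_bound y)).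
unfold scale_density; split; apply exp_le_exp; lra.
Qed.

Lemma scale_lipschitz y yb : Rabs (scale l y - scale l yb) <= exp (2 * C) * Rabs (y - yb).
Proof.
rewrite scale_sub, Rmult_comm.
apply abs_RInt_le_len_mul; [apply continuous_scale_density|].
intros t _; rewrite Rabs_right by (left; apply exp_pos).
apply scale_density_bounds.
Qed.

Lemma scale_increment_ge a b : a <= b ->
  exp (- (2 * C)) * (b - a) <= scale l b - scale l a.
Proof.
intros ab; rewrite scale_sub.
apply RInt_ge_len_mul; auto using continuous_scale_density.
intros t _; apply scale_density_bounds.
Qed.

Lemma scale_increment_abs_ge a b :
  exp (- (2 * C)) * Rabs (b - a) <= Rabs (scale l b - scale l a).
Proof.
pose proof (exp_pos (- (2 * C))).
destruct (Rle_or_lt a b) as [ab|ab].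
- pose proof (scale_increment_ge a b ab).
  rewrite (Rabs_right (b - a)) by lra; rewrite Rabs_right; nra.
- pose proof (scale_increment_ge b a (Rlt_le _ _ ab)).
  rewrite (Rabs_left (b - a)) by lra; rewrite Rabs_left1; nra.
Qed.

Lemma scale_surjective z : exists y, scale l y = z.
Proof.
set (m := exp (- (2 * C))); assert (m_pos : 0 < m) by apply exp_pos.
set (K := Rabs z / m).
assert (K_ge0 : 0 <= K) by (apply Rdiv_le_0_compat; [apply Rabs_pos|lra]).
assert (mK : m * K = Rabs z) by (unfold K; field; lra).
pose proof (scale_increment_ge 0 K K_ge0) as HK.
pose proof (scale_increment_ge (- K) 0 ltac:(lra)) as HmK.
assert (scale0 : scale l 0 = 0) by exact (RInt_point 0 (scale_density l)).
rewrite scale0 in HK, HmK; fold m in HK, HmK.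
assert (scale_cont : continuity (scale l)).
{ intros x; apply continuity_pt_filterlim, (is_derive_cont _ _ _ (is_derive_scale x)). }
destruct (IVT_gen (scale l) (- K) K z scale_cont) as [y [_ Hy]]; [|exists y; exact Hy].
pose proof (Rle_abs z); pose proof (Rle_abs (- z)); rewrite Rabs_Ropp in *.
split; [apply Rle_trans with (scale l (- K)); [apply Rmin_l|nra]
       |apply Rle_trans with (scale l K); [nra|apply Rmax_r]].
Qed.

Lemma scale_scale_inv z : scale l (scale_inv l z) = z.
Proof. unfold scale_inv; apply epsilon_spec, scale_surjective. Qed.

Lemma scale_injective a b : scale l a = scale l b -> a = b.
Proof.
intros E; pose proof (scale_increment_abs_ge a b) as H.
rewrite E, Rminus_diag, Rabs_R0 in H.
pose proof (exp_pos (- (2 * C))); pose proof (Rabs_pos (b - a)).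
assert (Rabs (b - a) = 0) by nra.
apply Rabs_eq_0 in H2; lra.
Qed.

Lemma scale_inv_scale y : scale_inv l (scale l y) = y.
Proof. apply scale_injective, scale_scale_inv. Qed.

Lemma scale_inv_lipschitz z w :
  Rabs (scale_inv l z - scale_inv l w) <= exp (2 * C) * Rabs (z - w).
Proof.
pose proof (scale_increment_abs_ge (scale_inv l w) (scale_inv l z)) as H.
rewrite !scale_scale_inv in H.
apply Rmult_le_compat_l with (r := exp (2 * C)) in H; [|left; apply exp_pos].
rewrite <- Rmult_assoc, <- exp_plus, Rplus_opp_r, exp_0, Rmult_1_l in H; exact H.
Qed.

Lemma continuous_scale_inv z : continuity_pt (scale_inv l) z.
Proof.
apply continuity_pt_locally; intros eps.
pose proof (exp_pos (2 * C)).
assert (d_pos : 0 < eps / exp (2 * C)) by (apply Rdiv_lt_0_compat; [apply cond_pos|lra]).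
apply (locally_between _ z (z - eps / exp (2 * C)) (z + eps / exp (2 * C))); [lra|].
intros y Hy; eapply Rle_lt_trans; [apply scale_inv_lipschitz|].
assert (Rabs (y - z) < eps / exp (2 * C)) by (apply Rabs_def1; lra).
replace (pos eps) with (exp (2 * C) * (eps / exp (2 * C))) by (field; lra).
apply Rmult_lt_compat_l; lra.
Qed.

Lemma scale_inv_le a b : a <= b -> scale_inv l a <= scale_inv l b.
Proof.
intros ab; destruct (Rle_or_lt (scale_inv l a) (scale_inv l b)) as [|lt_ba]; auto.
pose proof (scale_increment_ge _ _ (Rlt_le _ _ lt_ba)) as H.
rewrite !scale_scale_inv in H.
pose proof (exp_pos (- (2 * C))).
assert (0 < exp (- (2 * C)) * (scale_inv l a - scale_inv l b)) by (apply Rmult_lt_0_compat; lra).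
lra.
Qed.

Lemma is_derive_scale_inv z : is_derive (scale_inv l) z (scale_inv_density l z).
Proof.
apply is_derive_Reals.
set (dscale := fun a (_ : scale_inv l (z - 1) <= a <= scale_inv l (z + 1)) =>
  exist (fun d => derivable_pt_lim (scale l) a d) (scale_density l a)
    (proj1 (is_derive_Reals _ _ _) (is_derive_scale a))).
assert (inv_between : scale_inv l (z - 1) <= scale_inv l z <= scale_inv l (z + 1))
  by (split; apply scale_inv_le; lra).
replace (scale_inv_density l z) with (1 / scale_density l (scale_inv l z))
  by (unfold scale_inv_density, scale_density; rewrite exp_Ropp; unfold Rdiv; ring).
apply (Ranalysis5.derivable_pt_lim_recip_interv (scale l) (scale_inv l) (z - 1) (z + 1) z
  dscale (continuous_scale_inv z) ltac:(lra) ltac:(lra) inv_between).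
- intros x _; apply scale_scale_inv.
- apply Rgt_not_eq, exp_pos.
Qed.

Lemma is_derive_scale_inv_density z :
  is_derive (scale_inv_density l) z
    (- (2 * (l (scale_inv l z) * scale_inv_density l z)) * scale_inv_density l z).
Proof.
apply (is_derive_comp exp (fun z => - (2 * RInt l 0 (scale_inv l z)))); [apply is_derive_exp|].
apply (is_derive_opp (fun z => 2 * RInt l 0 (scale_inv l z))).
apply (is_derive_eq _ _ (scal (scale_inv_density l z) (2 * l (scale_inv l z))));
  [|unfold scal; simpl; unfold mult; simpl; ring].
apply (is_derive_comp (fun u => 2 * RInt l 0 u) (scale_inv l)).
- apply is_derive_double_primitive.
- apply is_derive_scale_inv.
Qed.

Lemma scale_C2_diffeo :
  (forall y, scale_inv l (scale l y) = y) /\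
  (forall y, scale l (scale_inv l y) = y) /\
  (forall y, ex_derive (scale l) y /\ ex_derive (Derive (scale l)) y) /\
  (forall y, continuous (Derive (Derive (scale l))) y) /\
  (forall y, ex_derive (scale_inv l) y /\ ex_derive (Derive (scale_inv l)) y) /\
  (forall y, continuous (Derive (Derive (scale_inv l))) y).
Proof.
assert (inv_density_cont : forall z, continuous (scale_inv_density l) z)
  by (intros z; apply (is_derive_cont _ _ _ (is_derive_scale_inv_density z))).
destruct (C2_of_derivatives _ _ _ is_derive_scale is_derive_scale_density)
  as [scale_D2 scale_D2_cont].
{ intros y; apply (continuous_mult (K:=R_AbsRing)); [|apply continuous_scale_density].
  apply (continuous_mult (K:=R_AbsRing)); [apply continuous_const|apply l_cont]. }
destruct (C2_of_derivatives _ _ _ is_derive_scale_inv is_derive_scale_inv_density)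
  as [inv_D2 inv_D2_cont].
{ intros z; apply (continuous_mult (K:=R_AbsRing)); [|apply inv_density_cont].
  apply (continuous_opp (V:=R_NormedModule)), (continuous_mult (K:=R_AbsRing));
    [apply continuous_const|apply (continuous_mult (K:=R_AbsRing)); [|apply inv_density_cont]].
  apply (continuous_comp (scale_inv l) l); [|apply l_cont].
  apply continuity_pt_filterlim, continuous_scale_inv. }
repeat split; auto using scale_inv_scale, scale_scale_inv;
  apply scale_D2 || apply inv_D2.
Qed.

End Scale.

Definition scale_dt_integrand (l l' : R -> R -> R) s u :=
  scale_density (l s) u * (2 * RInt (l' s) 0 u).

Definition scale_dt (l l' : R -> R -> R) s y := RInt (scale_dt_integrand l l' s) 0 y.

Section ScaleTime.

Variables (T : R) (l l' : R -> R -> R).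
Hypothesis l_cont : forall s u, continuity_2d_pt l s u.
Hypothesis l'_cont : forall s u, continuity_2d_pt l' s u.
Hypothesis l_deriv : forall s r, 0 < s < T -> is_derive (fun z => l z r) s (l' s r).

Lemma continuity_2d_pt_scale_density s u :
  continuity_2d_pt (fun s u => scale_density (l s) u) s u.
Proof.
apply (continuity_1d_2d_pt_comp exp (fun s u => 2 * RInt (l s) 0 u)).
- apply continuity_pt_filterlim, continuous_exp.
- apply continuity_2d_pt_mult; [apply continuity_2d_pt_const|apply continuity_2d_pt_RInt, l_cont].
Qed.

Lemma continuity_2d_pt_scale_dt_integrand s u :
  continuity_2d_pt (scale_dt_integrand l l') s u.
Proof.
apply continuity_2d_pt_mult; [apply continuity_2d_pt_scale_density|].
apply continuity_2d_pt_mult; [apply continuity_2d_pt_const|apply continuity_2d_pt_RInt, l'_cont].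
Qed.

Lemma is_derive_scale_density_time s u : 0 < s < T ->
  is_derive (fun z => scale_density (l z) u) s (scale_dt_integrand l l' s u).
Proof.
intros Hs.
apply (is_derive_eq _ _ (scal (2 * RInt (l' s) 0 u) (scale_density (l s) u)));
  [|unfold scal, scale_dt_integrand; simpl; unfold mult; simpl; ring].
apply (is_derive_comp exp (fun z => 2 * RInt (l z) 0 u)); [apply is_derive_exp|].
apply (is_derive_scal (fun z => RInt (l z) 0 u)).
apply (is_derive_RInt_param_cont l l_cont l'); [|apply l'_cont].
apply (locally_between _ s 0 T Hs); intros z Hz r; apply l_deriv, Hz.
Qed.

Lemma is_derive_scale_time s y : 0 < s < T ->
  is_derive (fun z => scale (l z) y) s (scale_dt l l' s y).
Proof.
intros Hs.
apply (is_derive_RInt_param_cont (fun z u => scale_density (l z) u)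
  continuity_2d_pt_scale_density (scale_dt_integrand l l'));
  [|apply continuity_2d_pt_scale_dt_integrand].
apply (locally_between _ s 0 T Hs); intros z Hz u; apply is_derive_scale_density_time, Hz.
Qed.

Lemma continuity_2d_pt_scale_dt s y : continuity_2d_pt (scale_dt l l') s y.
Proof. apply continuity_2d_pt_RInt, continuity_2d_pt_scale_dt_integrand. Qed.

Variables C C' : R.
Hypothesis l_bound : forall s u, Rabs (RInt (l s) 0 u) <= C.
Hypothesis l'_bound : forall s u, Rabs (RInt (l' s) 0 u) <= C'.

Lemma scale_dt_lipschitz s y yb :
  Rabs (scale_dt l l' s y - scale_dt l l' s yb) <= exp (2 * C) * (2 * C') * Rabs (y - yb).
Proof.
assert (integrand_cont : forall u, continuous (scale_dt_integrand l l' s) u)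
  by (intros; apply continuity_2d_pt_snd, continuity_2d_pt_scale_dt_integrand).
unfold scale_dt; rewrite RInt_Chasles_sub, Rmult_comm by auto.
apply abs_RInt_le_len_mul; auto.
intros u _; unfold scale_dt_integrand.
rewrite Rabs_mult, Rabs_mult, (Rabs_right 2), Rabs_right by (try left; try apply exp_pos; lra).
pose proof (scale_density_bounds (l s) C (l_bound s) u).
pose proof (l'_bound s u); pose proof (Rabs_pos (RInt (l' s) 0 u)).
apply Rmult_le_compat; [left; apply exp_pos|lra|unfold scale_density in *; lra|lra].
Qed.

End ScaleTime.

Theorem lemma5p1 (T : R) (lam lam_t : R -> R -> R) :
  0 < T ->
  (* lambda continuous on [0,T] x R *)
  cont_on_strip T lam ->
  (* (i) *)
  L1 (sup_abs_t T lam) ->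
  (* (ii) lambda_t exists (one-sided at t = 0, T; see NOTES), is continuous *)
  (forall t y, 0 < t < T -> is_derive (fun s => lam s y) t (lam_t t y)) ->
  cont_on_strip T lam_t ->
  L1 (sup_abs_t T lam_t) ->
  let phi := fun t y =>
    RInt (fun s => exp (2 * RInt (fun r => lam t r) 0 s)) 0 y in
  (* phi_yy - 2 lambda phi_y = 0 *)
  (forall t y, 0 <= t <= T ->
     ex_derive (phi t) y /\
     is_derive (fun z => Derive (phi t) z) y (2 * lam t y * Derive (phi t) y)) /\
  (* 1. bijection, C^2 with C^2 inverse, uniformly Lipschitz *)
  (exists phi_inv : R -> R -> R,
     (forall t, 0 <= t <= T ->
        (forall y, phi_inv t (phi t y) = y) /\
        (forall y, phi t (phi_inv t y) = y) /\
        (forall y, ex_derive (phi t) y /\ ex_derive (Derive (phi t)) y) /\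
        (forall y, continuous (Derive (Derive (phi t))) y) /\
        (forall y, ex_derive (phi_inv t) y /\ ex_derive (Derive (phi_inv t)) y) /\
        (forall y, continuous (Derive (Derive (phi_inv t))) y)) /\
     exists L, forall t y yb, 0 <= t <= T ->
        Rabs (phi t y - phi t yb) <= L * Rabs (y - yb) /\
        Rabs (phi_inv t y - phi_inv t yb) <= L * Rabs (y - yb)) /\
  (* 2. phi_y positive and bounded *)
  (forall t y, 0 <= t <= T -> 0 < Derive (phi t) y) /\
  (exists M, forall t y, 0 <= t <= T -> Derive (phi t) y <= M) /\
  (* phi_t exists, continuous in t, Lipschitz in y *)
  (exists phi_t : R -> R -> R,
     (forall t y, 0 < t < T -> is_derive (fun s => phi s y) t (phi_t t y)) /\
     (forall y t, 0 <= t <= T -> forall eps, 0 < eps -> exists delta, 0 < delta /\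
        forall t', 0 <= t' <= T -> Rabs (t' - t) < delta ->
          Rabs (phi_t t' y - phi_t t y) < eps) /\
     exists K, forall t y yb, 0 <= t <= T ->
        Rabs (phi_t t y - phi_t t yb) <= K * Rabs (y - yb)).
Proof.
intros T_pos lam_cont lam_L1 lam_deriv lam_t_cont lam_t_L1 phi.
assert (T_ge0 : 0 <= T) by lra.
change phi with (fun t => scale (lam t)); cbv beta.
destruct (primitive_extend_bounded T T_ge0 lam lam_cont lam_L1) as [C HC].
destruct (primitive_extend_bounded T T_ge0 lam_t lam_t_cont lam_t_L1) as [C' HC'].
assert (l_cont := continuity_2d_pt_extend T T_ge0 lam lam_cont).
assert (l'_cont := continuity_2d_pt_extend T T_ge0 lam_t lam_t_cont).
assert (lam_cont_y : forall t, 0 <= t <= T -> forall y, continuous (lam t) y).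
{ intros t Ht y; rewrite <- (extend_eq T lam t Ht); apply continuity_2d_pt_snd, l_cont. }
assert (lam_bound : forall t, 0 <= t <= T -> forall u, Rabs (RInt (lam t) 0 u) <= C).
{ intros t Ht; rewrite <- (extend_eq T lam t Ht); apply HC. }
split; [|split; [|split; [|split]]].
- intros t y Ht; apply scale_ode, lam_cont_y, Ht.
- exists (fun t => scale_inv (lam t)); split.
  + intros t Ht; apply (scale_C2_diffeo _ (lam_cont_y t Ht) C (lam_bound t Ht)).
  + exists (exp (2 * C)); intros t y yb Ht; split;
      [apply scale_lipschitz|apply scale_inv_lipschitz]; auto.
- intros t y Ht; rewrite Derive_scale by auto; apply exp_pos.
- exists (exp (2 * C)); intros t y Ht; rewrite Derive_scale by auto.
  apply (scale_density_bounds _ C (lam_bound t Ht)).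
- exists (scale_dt (extend T lam) (extend T lam_t)); split; [|split].
  + intros t y Ht.
    apply (is_derive_ext_loc (fun z => scale (extend T lam z) y)).
    { apply (locally_between _ t 0 T Ht); intros z Hz; rewrite extend_eq by lra; reflexivity. }
    exact (is_derive_scale_time T _ _ l_cont l'_cont (is_derive_extend T lam lam_t lam_deriv) t y Ht).
  + intros y t _ eps eps_pos.
    destruct (continuity_2d_pt_scale_dt _ _ l_cont l'_cont t y (mkposreal eps eps_pos)) as [d Hd].
    exists d; split; [apply cond_pos|]; intros t' _ Ht'.
    apply Hd; [exact Ht'|rewrite Rminus_diag, Rabs_R0; apply cond_pos].
  + exists (exp (2 * C) * (2 * C')); intros t y yb _; apply scale_dt_lipschitz; auto.
Qed.
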